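(* Let $R$ be a ring with identity and let $F$ parametrize a cochain complex of free $R$-modules of finite rank over a finite graded poset $(X,\leq)$. Let $\Sigma$ be the $F$-compatible acyclic matching on $(X,\leq)$ produced by the algorithm Scythe run on $F$ (described in the context), and set: - $n = |X|$; - $p = \max_{x\in X}|x_+|$, where $x_+=\{y\in X : x\prec y\}$; - $d = \max_{x\in X}\operatorname{rank} F(x) < \infty$; - $\tilde m = \sum_k m_k^2$, where $m_k$ is the number of $k$-dimensional critical (unpaired) elements of $\Sigma$; - $\omega$ the matrix multiplication exponent over $R$, i.e. composing two $d\times d$ matrices with entries in $R$ (and also inverting an invertible one) costs $O(d^\omega)$. Then the time complexity of constructing the Morse parametrization $F^\Sigma$ via Scythe is $O(n\,p\,\tilde m\,d^{\omega})$ and the space complexity is $O(n^2\,p\,d^2)$.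
   Context: $R$ is a fixed coefficient ring with identity. In a poset, $x\prec y$ ($y$ covers $x$) means $x<y$ and there is no $z$ with $x<z<y$. A poset $(X,\le)$ is graded if $X=\bigsqcup_{n\in\mathbb N}X_n$ (elements of $X_n$ have dimension $n$) such that $x\prec y$ implies $\dim y=\dim x+1$. Write $x_+=\{y: x\prec y\}$ and $y_-=\{x: x\prec y\}$. A parametrization $F$ of a cochain complex $(C^\bullet,d^\bullet)$ over $(X,\le)$ assigns to each $x\in X$ an $R$-module $F(x)$ and to each covering relation $x\prec y$ a linear map $F_{xy}:F(x)\to F(y)$ (with $F_{xy}=0$ by convention when $x\not\prec y$), such that $C^n=\bigoplus_{x\in X_n}F(x)$ and the block of $d^n$ from $F(x)$ to $F(y)$ is $F_{xy}$. A partial matching on $X$ is a set $\Sigma\subset X\times X$ of pairs $(x,y)$ with $x\prec y$ such that no element of $X$ lies in more than one pair. It is acyclic if the transitive closure of the relation $(x,y)\lhd(x',y')\iff x\prec y'$ on $\Sigma$ is a partial order. It is $F$-compatible if $F_{xy}$ is invertible for all $(x,y)\in\Sigma$. The elements of $X$ in no pair of $\Sigma$ are called critical; $M$ is the set of critical elements. A gradient path is a strictly $\lhd$-increasing sequence of pairs $(x_j,y_j)_{j=1}^J$ in $\Sigma$ ($J\ge 1$), arranged as $\gamma=y_1\succ x_1\prec y_2\succ x_2\prec\cdots\prec y_J\succ x_J$, with coindex $F_\gamma=(-F_{x_Jy_J}^{-1})\circ F_{x_{J-1}y_J}\circ\cdots\circ F_{x_1y_2}\circ(-F_{x_1y_1}^{-1}):F(y_1)\to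 F(x_J)$. For $m,m'\in M$, $\gamma$ flows from $m$ to $m'$ if $m\prec y_1$ and $x_J\prec m'$. The Morse parametrization $F^\Sigma$ is given on $M$ by $F^\Sigma(m)=F(m)$ and $F^\Sigma_{mm'}=F_{mm'}+\sum_\gamma F_{x_J m'}\circ F_\gamma\circ F_{m y_1}$, the sum being over all gradient paths $\gamma$ flowing from $m$ to $m'$. Subroutine ReducePair$(x^\star,y^\star)$ (for $x^\star\prec y^\star$ with $F_{x^\star y^\star}$ invertible): for each $z\in x^\star_+\setminus\{y^\star\}$ and each $w\in y^\star_-\setminus\{x^\star\}$, set $w\prec z$ and replace $F_{wz}$ by $F_{wz}-F_{x^\star z}\circ F_{x^\star y^\star}^{-1}\circ F_{wy^\star}$; then remove $x^\star$ and $y^\star$ from $X$. Algorithm Scythe (modifies $X$ and $F$ in place; initially no element is marked critical; the sets $x_\pm$, $y_\pm$ refer to the current poset): 1. While $X$ has elements not marked critical: 2. select a minimal element $c$ among the non-critical elements of $X$ and mark it critical; 3. set the queue Que to be empty and enqueue $c$; 4. while Que is nonempty: dequeue $y$; if $y_-$ contains exactly one non-critical element $x$, and $F_{xy}$ is invertible, then enqueue $x_+\setminus\{y\}$ and call ReducePair$(x,y)$; in any case, then enqueue (the elements of) $y_+$ (as it was before a possible removal of $y$). Queue conventions: an element that has been enqueued is flagged and cannot be enqueued again until Que is reinitialized in step 3 (when all flags are cleared); apart from the element $c$ just selected, no critical elements are enqueued; elements removed from $X$ are disregarded; and, for the purposes of the complexity analysis, only elements of dimension $\dim c+1$ (besides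 $c$ itself) are enqueued. The matching $\Sigma$ is the set of pairs $(x,y)$ for which ReducePair$(x,y)$ is called; at termination $(X,F)$ has been transformed into the set $M$ of critical elements with the Morse parametrization $F^\Sigma$. *)

(* Defs.v *)
From mathcomp Require Import all_boot all_order all_algebra.
From mathcomp Require Import classical_sets reals exp.

Set Implicit Arguments.
Unset Strict Implicit.
Unset Printing Implicit Defensive.

Import Order.TTheory GRing.Theory Num.Theory.
Local Open Scope ring_scope.

Section GradedPosets.
Context {disp : Order.disp_t} {X : finPOrderType disp}.
Implicit Types (x y : X).

Definition covers x y : bool :=
  (x < y)%O && [forall z, ~~ ((x < z)%O && (z < y)%O)].

Definition graded (dim : X -> nat) : Prop :=
  forall x y, covers x y -> dim y = (dim x).+1.

Definition max_upper_covers : nat := (\max_(x : X) #|[set y | covers x y]|)%N.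

End GradedPosets.

Arguments max_upper_covers {disp} X.

Section Inverses.
Context {R : pzRingType} {a b : nat}.
Implicit Types (A : 'M[R]_(a, b)) (B : 'M[R]_(b, a)).

(* R need not be commutative, so [unitmx] and [invmx] are not available. *)
Definition is_inverse A B : Prop := A *m B = 1%:M /\ B *m A = 1%:M.

Definition invertible A : Prop := exists B, is_inverse A B.

Definition inverse A : 'M[R]_(b, a) := xget 0 [set B | is_inverse A B]%classic.

End Inverses.

(* Every F(x) is free of finite rank and comes with a basis: F(x) is the
   module of row vectors 'rV[R]_(rk x), and F_xy is v |-> v *m blk x y.  With
   row vectors the composite G \o F is the product [F *m G].  A cochain of
   degree k is a family v : forall x, 'rV_(rk x), of which only the entries
   over X_k matter. *)
Definition coboundary {R : pzRingType} {X : finType} (dim rk : X -> nat)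
    (blk : forall x y : X, 'M[R]_(rk x, rk y)) (k : nat)
    (v : forall x, 'rV[R]_(rk x)) (y : X) : 'rV[R]_(rk y) :=
  if dim y == k.+1 then \sum_(x | dim x == k) v x *m blk x y else 0.

Record parametrization (R : pzRingType) (disp : Order.disp_t)
    (X : finPOrderType disp) (dim : X -> nat) := Parametrization {
  rk : X -> nat;
  blk : forall x y : X, 'M[R]_(rk x, rk y);
  blk_notcovers : forall x y, ~~ covers x y -> blk x y = 0;
  coboundaryK : forall k (v : forall x, 'rV[R]_(rk x)) y,
    coboundary dim blk k.+1 (coboundary dim blk k v) y = 0
}.

Section Morse.
Context {R : pzRingType} {disp : Order.disp_t} {X : finPOrderType disp}.
Context {dim : X -> nat}.
Implicit Types (F : parametrization R dim) (S : {set X * X}) (x y m : X).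
Implicit Types (p q : X * X) (g : seq (X * X)).

Definition max_rank F : nat := (\max_(x : X) rk F x)%N.

Definition partial_matching S : Prop :=
  (forall p, p \in S -> covers p.1 p.2) /\
  (forall x p q, p \in S -> q \in S ->
     x \in [:: p.1; p.2] -> x \in [:: q.1; q.2] -> p = q).

Definition flow_rel S : rel (X * X) :=
  [rel p q | [&& p \in S, q \in S & covers p.1 q.2]].

(* [flow_rel S] is reflexive on S, so that on S its transitive closure is
   [connect (flow_rel S)], and only antisymmetry has to be required of it. *)
Definition acyclic S : Prop :=
  {in S &, antisymmetric (connect (flow_rel S))}.

Definition compatible F S : Prop :=
  forall p, p \in S -> invertible (blk F p.1 p.2).

Definition critical S : {set X} :=
  [set x | [forall p in S, (x != p.1) && (x != p.2)]].

Definition ncritical S (k : nat) : nat := #|[set x in critical S | dim x == k]|.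

Definition sum_sqr_critical S : nat :=
  (\sum_(k < (\max_(x : X) dim x).+1) ncritical S k ^ 2)%N.

(* The sequence of the pairs (x_j, y_j). *)
Definition gradient_path S g : bool :=
  [&& g != [::], all (mem S) g &
      sorted [rel p q | (p != q) && flow_rel S p q] g].

Definition flows_from_to m g m' : bool :=
  if g is p :: g' then covers m p.2 && covers (last p g').1 m' else false.

(* F_{x_J m'} \o F_g \o F_{m y_1}, for g = (x_1, y_1) ... (x_J, y_J). *)
Fixpoint flow_block F m g m' : 'M[R]_(rk F m, rk F m') :=
  if g is (x, y) :: g' then
    blk F m y *m (- inverse (blk F x y)) *m flow_block F x g' m'
  else blk F m m'.

(* The pairs of a gradient path of an acyclic matching are pairwise distinct,
   hence its length J is at most #|X|. *)
Definition morse_blk F S m m' : 'M[R]_(rk F m, rk F m') :=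
  blk F m m' +
  \sum_(J < #|X|.+1)
    \sum_(g : J.-tuple (X * X) | gradient_path S g && flows_from_to m g m')
      flow_block F m g m'.

End Morse.

(* The running time and working space of the routines for multiplying two
   matrices over R, and for inverting a matrix or finding that it is not
   invertible. *)
Record matrix_routines (R : pzRingType) := MatrixRoutines {
  mul_time : forall a b c, 'M[R]_(a, b) -> 'M[R]_(b, c) -> nat;
  mul_space : forall a b c, 'M[R]_(a, b) -> 'M[R]_(b, c) -> nat;
  inv_time : forall a b, 'M[R]_(a, b) -> nat;
  inv_space : forall a b, 'M[R]_(a, b) -> nat;
  (* all entries of the product have to be written *)
  mul_time_output : forall a b c (A : 'M[R]_(a, b)) (B : 'M[R]_(b, c)),
    (a * c <= mul_time A B)%N
}.

(* O(d ^ omega) time for matrices with at most d rows and columns; a smaller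
   or rectangular block is handled as part of a d x d matrix. *)
Definition multiplication_exponent (R : pzRingType) (K : realType)
    (T : matrix_routines R) (omega : K) : Prop :=
  exists kappa : K, forall d a b c : nat,
    (0 < d)%N -> (a <= d)%N -> (b <= d)%N -> (c <= d)%N ->
    (forall (A : 'M[R]_(a, b)) (B : 'M[R]_(b, c)),
       (mul_time T A B)%:R <= kappa * d%:R `^ omega) /\
    (forall A : 'M[R]_(a, b), (inv_time T A)%:R <= kappa * d%:R `^ omega).

Definition quadratic_space (R : pzRingType) (T : matrix_routines R) : Prop :=
  exists kappa : nat, forall d a b c : nat,
    (0 < d)%N -> (a <= d)%N -> (b <= d)%N -> (c <= d)%N ->
    (forall (A : 'M[R]_(a, b)) (B : 'M[R]_(b, c)),
       mul_space T A B <= kappa * d ^ 2)%N /\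
    (forall A : 'M[R]_(a, b), inv_space T A <= kappa * d ^ 2)%N.

(* Scythe as a transition system.  The free choices of the algorithm (which
   minimal element is selected, in which order a set is enqueued) are
   nondeterministic.  Memory is counted in words, each holding an element of R,
   a cell or a pointer; time is counted in elementary operations on words, plus
   the time taken by the matrix routines. *)
Section Scythe.
Context {R : pzRingType} {disp : Order.disp_t} {X : finPOrderType disp}.
Context {dim : X -> nat} (T : matrix_routines R) (F : parametrization R dim).
Implicit Types (x y z w c : X) (A : {set X}) (q l : seq X).

Record state := State {
  alive : {set X};
  marked : {set X};           (* critical *)
  cov : {set X * X};          (* the current covers *)
  cur : forall x y : X, 'M[R]_(rk F x, rk F y);  (* the current maps F_xy *)
  queue : seq X;
  flagged : {set X};
  level : nat;                (* dim c, for the last selected c *)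
  matching : {set X * X}      (* Sigma so far *)
}.
Implicit Types s : state.

Definition initial : state :=
  State [set: X]%SET finset.set0 [set p | covers p.1 p.2] (blk F) [::]
    finset.set0 0 finset.set0.

Definition unmarked s : {set X} := alive s :\: marked s.
Definition up s x : {set X} := [set y | (x, y) \in cov s].
Definition down s y : {set X} := [set x | (x, y) \in cov s].

Definition final s : Prop := queue s = [::] /\ unmarked s = finset.set0.

(* Minimality is for the order generated by the current covering relation. *)
Definition minimal_unmarked s c : Prop :=
  c \in unmarked s /\
  forall x, x \in unmarked s -> connect [rel u v | (u, v) \in cov s] x c ->
    x = c.

Definition select s c : state :=
  State (alive s) (c |: marked s) (cov s) (cur s) [:: c] [set c] (dim c)
    (matching s).

(* The minimal elements are found by going through the current elements, and
   recording for each unmarked x that the elements of x_+ are not minimal.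
   Then the flags are cleared. *)
Definition select_time s : nat :=
  (1 + #|alive s| + \sum_(x in unmarked s) #|up s x| + #|flagged s|)%N.
Definition select_space : nat := #|X|.

Definition pop s : state :=
  State (alive s) (marked s) (cov s) (cur s) (behead (queue s)) (flagged s)
    (level s) (matching s).

(* l lists, in any order, the elements that enqueuing A puts in the queue. *)
Definition enqueued s A l : Prop :=
  perm_eq l (enum [set z in A | [&& z \in unmarked s, z \notin flagged s
                                   & dim z == (level s).+1]]).

Definition push s l : state :=
  State (alive s) (marked s) (cov s) (cur s) (queue s ++ l)
    (flagged s :|: [set:: l]) (level s) (matching s).

Definition reduced_cov s x y : {set X * X} :=
  [set p in cov s :|: finset.setX (down s y :\ x) (up s x :\ y)
     | [&& p.1 != x, p.1 != y, p.2 != x & p.2 != y]].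

Definition reduced_cur s x y (w z : X) : 'M[R]_(rk F w, rk F z) :=
  if (z \in up s x :\ y) && (w \in down s y :\ x) then
    cur s w z - cur s w y *m inverse (cur s x y) *m cur s x z
  else cur s w z.

Definition reduce_pair s x y : state :=
  State (alive s :\ x :\ y) (marked s) (reduced_cov s x y) (reduced_cur s x y)
    (queue s) (flagged s) (level s) ((x, y) |: matching s).

(* For every z and w, the covering relation, two products and a difference of
   matrices; then x and y are taken out of all lists in which they occur.  The
   inverse of [cur s x y] is known from [test_time]. *)
Definition reduce_time s x y : nat :=
  (1 + \sum_(z in up s x :\ y) \sum_(w in down s y :\ x)
         (1 + mul_time T (cur s w y) (inverse (cur s x y))
            + mul_time T (cur s w y *m inverse (cur s x y)) (cur s x z)
            + rk F w * rk F z)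
     + #|up s x| + #|down s x| + #|up s y| + #|down s y|)%N.

Definition reduce_space s x y : nat :=
  (rk F y * rk F x + inv_space T (cur s x y)
     + \max_(z in up s x :\ y) \max_(w in down s y :\ x)
         (rk F w * rk F x + rk F w * rk F z
            + mul_space T (cur s w y) (inverse (cur s x y))
            + mul_space T (cur s w y *m inverse (cur s x y)) (cur s x z)))%N.

Definition unmarked_below s y : {set X} := down s y :&: unmarked s.

Definition matchable s x y : Prop :=
  unmarked_below s y = [set x] /\ invertible (cur s x y).

(* y_- is searched; if it contains exactly one unmarked x, the inverse of
   F_xy is computed. *)
Definition test_time s y : nat :=
  (#|down s y|
     + \sum_(x in unmarked_below s y | #|unmarked_below s y| == 1%N)
         inv_time T (cur s x y))%N.
Definition test_space s y : nat :=
  (\sum_(x in unmarked_below s y | #|unmarked_below s y| == 1%N)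
     (rk F x * rk F y + inv_space T (cur s x y)))%N.

(* [step s t m s']: one iteration of a loop of Scythe leads from s to s', in
   time t and with working space m. *)
Inductive step s : nat -> nat -> state -> Prop :=
| StepSelect c of queue s = [::] & minimal_unmarked s c :
    step s (select_time s) select_space (select s c)
| StepRemoved y q of queue s = y :: q & y \notin alive s :
    step s 1 0 (pop s)
| StepKeep y q l of queue s = y :: q & y \in alive s
    & ~ (exists x, matchable s x y)
    & enqueued (pop s) (up s y) l :
    step s (1 + test_time s y + #|up s y|)%N (test_space s y)
      (push (pop s) l)
| StepReduce x y q l l' of queue s = y :: q & y \in alive s
    & matchable s x y
    & enqueued (pop s) (up s x :\ y) l
    & enqueued (reduce_pair (push (pop s) l) x y) (up s y) l' :
    step s (1 + test_time s y + #|up s x| + reduce_time s x y + #|up s y|)%N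
      (test_space s y + reduce_space s x y)%N
      (push (reduce_pair (push (pop s) l) x y) l').

(* One word for the record of each element, one for each pointer of the
   covering relation, and the entries of the matrices. *)
Definition storage s : nat :=
  (#|X| + \sum_(p in cov s) (1 + rk F p.1 * rk F p.2)
     + size (queue s) + #|flagged s| + 2 * #|matching s|)%N.

(* [run t m s]: the algorithm can reach s in time t with peak memory m.  The
   old and the new state may coexist in memory during a step. *)
Inductive run : nat -> nat -> state -> Prop :=
| RunInitial : run 0 (storage initial) initial
| RunStep t m s t' m' s' of run t m s & step s t' m' s' :
    run (t + t')%N (maxn m (storage s + storage s' + m')) s'.

(* Whatever the choices, Scythe stops, and it only stops in a final state. *)
Definition terminates : Prop :=
  Acc (fun s' s => exists t m, step s t m s') initial /\
  (forall t m s, run t m s ->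
     final s \/ exists t' m' s', step s t' m' s').

Definition computes_morse s : Prop :=
  [/\ partial_matching (matching s), acyclic (matching s),
      compatible F (matching s),
      alive s = critical (matching s)
    & {in critical (matching s) &, forall c c',
         cur s c c' = morse_blk F (matching s) c c'}].

End Scythe.

(* Main.v *)
(* When ReducePair(x, y) is called, x is the only unmarked element of y_-, so the
   elements w whose covers and maps are modified are all marked.  Hence the upper
   covers and the maps out of an unmarked element stay the original ones.  In
   particular Sigma is an F-compatible matching of the original poset, and no pair
   (x, y) flows into an earlier one, because the unmarked elements left have no
   cover among the y's already removed: this gives acyclicity, and it also shows
   that in a gradient path of Sigma + (x, y) the new pair can only come last.
   Splitting the paths accordingly, the update of F_wz performed by ReducePair is
   exactly the passage from the Morse maps of Sigma to those of Sigma + (x, y).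

   For the time bound, ReducePair(x, y) handles at most p elements z, and at most
   a_k elements w, where a_k is the number of marked elements of dimension
   k = dim x.  As a_k <= A := \sum_j a_j ^ 2, the n / 2 calls cost at most
   O(n p A B), where B bounds a matrix operation.  The round of a selected element of
   dimension k dequeues each element y of dimension k + 1 at most once, and y_- has
   at most a_k marked elements; the unmarked elements of all the sets y_- are at
   most n p in number.  So the round costs O(n p B (1 + a_k)), which is paid for by
   the increase of A when a_k grows to a_k + 1. *)
From mathcomp Require Import classical_sets reals exp.
From mathcomp Require Import all_boot all_order all_algebra zify.
Require Import Defs.

Set Implicit Arguments.
Unset Strict Implicit.
Unset Printing Implicit Defensive.

Import Order.TTheory GRing.Theory Num.Theory.
Local Open Scope ring_scope.

(** * Gradient paths *)

Section Paths.
Context {R : pzRingType} {disp : Order.disp_t} {X : finPOrderType disp}.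
Context {dim : X -> nat}.
Implicit Types (F : parametrization R dim) (S : {set X * X}) (x y w z : X).
Implicit Types (g : seq (X * X)).

Definition flow_step : rel (X * X) :=
  [rel p q | (p != q) && covers p.1 q.2].

(** The empty sequence is allowed: it contributes the direct term [blk F w z] of a Morse map. *)
Definition flow_path S g : bool := all (mem S) g && sorted flow_step g.

Lemma gradient_pathE S g : gradient_path S g = (g != [::]) && flow_path S g.
Proof.
rewrite /gradient_path /flow_path; congr (_ && _).
have [/allP gS|//] := boolP (all (mem S) g); rewrite /=.
apply: (@eq_in_sorted _ (mem S)); last exact/allP.
move=> p q pS qS; have pS' : p \in S := pS; have qS' : q \in S := qS.
by rewrite /flow_rel /flow_step /= pS' qS'.
Qed.

(** If an endpoint condition fails, the first or the last [blk] of the product is zero. So the flow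
    condition may be dropped from Morse sums. *)
Lemma flow_block_eq0 F w g z :
  g != [::] -> ~~ flows_from_to w g z -> flow_block F w g z = 0.
Proof.
case: g => // -[x y] g _ /=.
elim: g w x y => [|[x' y'] g IH] w x y /=.
  rewrite negb_and => /orP[] /blk_notcovers ->; first by rewrite !mul0mx.
  by rewrite mulmx0.
rewrite negb_and => /orP[/blk_notcovers ->|ncov]; first by rewrite !mul0mx.
by rewrite (IH x x' y') ?mulmx0 // negb_and ncov orbT.
Qed.

Lemma flow_block_rcons F w g x y z :
  flow_block F w (rcons g (x, y)) z =
  flow_block F w g y *m (- inverse (blk F x y)) *m blk F x z.
Proof.
elim: g w => [|[x' y'] g IH] w //=.
by rewrite IH !mulmxA.
Qed.

Definition path_sum F S w z J : 'M[R]_(rk F w, rk F z) :=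
  \sum_(g : J.-tuple (X * X) | flow_path S g) flow_block F w g z.

Lemma morse_blkE F S w z :
  morse_blk F S w z = \sum_(J < #|X|.+1) path_sum F S w z J.
Proof.
rewrite /morse_blk !big_ord_recl addrA; congr (_ + _); last first.
  apply: eq_bigr => J _; rewrite big_mkcond [RHS]big_mkcond /=.
  apply: eq_bigr => g _; rewrite gradient_pathE.
  have gn0 : tval g != [::] by rewrite -size_eq0 size_tuple.
  rewrite gn0 /=; have [flw|nflw] := boolP (flows_from_to w g z); first by rewrite andbT.
  by rewrite andbF; case: ifP => // _; rewrite flow_block_eq0.
rewrite big_pred0 ?addr0; last by move=> g; rewrite tuple0.
rewrite /path_sum (big_pred1 [tuple]) // => g.
by rewrite tuple0 /flow_path /= eqxx.
Qed.

(** * Morse maps after adding a pair that no pair of the matching can follow *)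

Section AddPair.
Context (S : {set X * X}) (x y : X).
Hypothesis xy_terminal : forall q, q \in S -> ~~ covers x q.2.
Hypothesis xy_notin : (x, y) \notin S.

Let S' := (x, y) |: S.

(** A new pair before the last place would be followed by a different pair, hence by one of [S],
    whose upper element would cover [x]; [xy_terminal] excludes this. *)
Lemma path_into_new g p :
  all (mem S') (rcons g p) -> sorted flow_step (rcons g p) -> all (mem S) g.
Proof.
elim: g => [//|q g IH]; rewrite rcons_cons => /= /andP[qS' gS'] qg.
rewrite IH ?(path_sorted qg) // andbT.
move: qS'; rewrite in_setU1 => /orP[/eqP eq|//].
have : exists q', q' \in S' /\ flow_step q q'.
  by case: g gS' qg {IH} => [|q' g] /= /andP[q'S' _] /andP[qq' _]; [exists p|exists q'].
case=> q' [q'S' /andP[nqq' /= cov]]; move: q'S'.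
rewrite in_setU1 -eq eq_sym (negPf nqq') /= => /xy_terminal.
by rewrite eq /= in cov; rewrite cov.
Qed.

Lemma flow_path_new J (g : J.-tuple (X * X)) :
  flow_path S' g && ~~ all (mem S) g ->
  exists g0, tval g = rcons g0 (x, y).
Proof.
rewrite /flow_path; case/lastP: {g}(tval g) => [//|g p].
move=> /andP[/andP[gS' sg] ngS]; exists g; congr rcons.
have := path_into_new gS' sg.
move: gS' ngS; rewrite !all_rcons /= in_setU1 => /andP[/orP[/eqP //|pS] _] + gS.
by rewrite pS gS.
Qed.

Lemma path_sum_addS F w z J :
  path_sum F S' w z J.+1 = path_sum F S w z J.+1 +
    path_sum F S w y J *m (- inverse (blk F x y)) *m blk F x z.
Proof.
rewrite /path_sum (bigID (fun g : J.+1.-tuple _ => all (mem S) g)) /=; congr (_ + _).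
  apply: eq_bigl => g; rewrite /flow_path.
  have [gS|] := boolP (all (mem S) g); last by rewrite andbF.
  rewrite andbT /=; suff -> : all (mem S') g by [].
  by apply: sub_all gS => p; rewrite /= in_setU1 => ->; rewrite orbT.
have h'E (t : J.+1.-tuple (X * X)) g0 p : tval t = rcons g0 p ->
    (belast (thead t) (behead t) = g0) * (last (thead t) (behead t) = p).
  case/tupleP: t => q t; rewrite theadE /= => eqt.
  by have := lastI q t; rewrite eqt => /rcons_inj[<- <-].
(* The paths leaving [S] are those that end in [(x, y)]; they are reindexed by dropping this last
   pair. *)
pose h (g : J.-tuple (X * X)) := [tuple of rcons g (x, y)].
pose h' (g : J.+1.-tuple (X * X)) := [tuple of belast (thead g) (behead g)].
rewrite (reindex_onto h h') /=; last first.
  move=> g /flow_path_new[g0 eqg]; apply: val_inj => /=.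
  by rewrite (h'E _ _ _ eqg) -eqg.
rewrite !mulmx_suml [RHS]big_mkcond /= big_mkcond; apply: eq_bigr => g _ /=.
rewrite flow_block_rcons.
have -> : (h' (h g) == g).
  by apply/eqP/val_inj; rewrite /= (h'E (h g) g (x, y)).
rewrite andbT all_rcons /= (negPf xy_notin) /= andbT.
have [/andP[gS sg]|ngS] := boolP (flow_path S g).
  have gS' : all (mem S') g.
    by apply: sub_all gS => p; rewrite /= in_setU1 => ->; rewrite orbT.
  rewrite /flow_path all_rcons gS' /= in_setU1 eqxx /=.
  (* If appending [(x, y)] gives no path, then [g] does not flow into [y] and its term is zero. *)
  case: ifP => // nsg; have gn0 : tval g != [::] by apply: contraFneq nsg => ->.
  rewrite flow_block_eq0 ?mul0mx //; apply: contraFN nsg.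
  case: (tval g) gn0 gS sg => //= p g' _ gS sg /andP[_ cov].
  rewrite rcons_path sg /flow_step /= cov andbT.
  apply: contraNneq xy_notin => <-.
  by have /allP := (gS : all (mem S) (p :: g')); apply; exact: mem_last.
case: ifP => // /andP[gS' sg]; case/negP: ngS; rewrite /flow_path (path_into_new gS' sg) /=.
by move: sg; rewrite -cats1; case: (tval g) => //= p g'; rewrite cat_path => /andP[].
Qed.

(** Lengths are cut off at [#|X|], and appending [(x, y)] adds one to the length. The hypothesis
    disposes of the top term of [morse_blk F S w y], which has no counterpart on the left. *)
Lemma morse_blk_setU1 F w z : path_sum F S w y #|X| = 0 ->
  morse_blk F S' w z = morse_blk F S w z +
    morse_blk F S w y *m (- inverse (blk F x y)) *m blk F x z.
Proof.
move=> no_long; rewrite !morse_blkE big_ord_recl [X in _ = X + _]big_ord_recl.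
rewrite [X in _ = _ + X *m _ *m _]big_ord_recr /= no_long addr0.
rewrite !mulmx_suml -addrA -big_split /=; congr (_ + _).
  by apply: eq_bigl => g; rewrite tuple0.
by apply: eq_bigr => J _; rewrite path_sum_addS.
Qed.

End AddPair.

(** Heights increase strictly along a path and stay below [#|S|], so no path has more than [#|S|]
    pairs. *)
Lemma path_sum_eq0 F S w z J (ht : X * X -> nat) :
  (forall p, p \in S -> (ht p < #|S|)%N) ->
  (forall p q, p \in S -> q \in S -> covers p.1 q.2 ->
     p = q \/ (ht p < ht q)%N) ->
  (#|S| < J)%N -> path_sum F S w z J = 0.
Proof.
move=> ht_lt ht_mono SJ; rewrite /path_sum big_pred0 // => g.
apply/negP => /andP[gS sg].
have sorted_ht : sorted ltn (map ht g).
  rewrite sorted_map; apply: (@sub_in_sorted _ (mem S) flow_step) sg => //.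
  move=> p q pS qS /= /andP[npq cov].
  by have [eqpq|] := ht_mono p q pS qS cov; first by rewrite eqpq eqxx in npq.
have : (size (map ht g) <= size (iota 0 #|S|))%N.
  apply: uniq_leq_size; first exact: sorted_uniq ltn_trans ltnn _ sorted_ht.
  move=> k /mapP[p pg ->]; rewrite mem_iota /= add0n; apply: ht_lt.
  exact: (allP gS).
by rewrite size_map size_tuple size_iota leqNgt SJ.
Qed.

Lemma acyclic_height S (ht : X * X -> nat) :
  (forall p q, p \in S -> q \in S -> covers p.1 q.2 ->
     p = q \/ (ht p < ht q)%N) -> acyclic S.
Proof.
move=> ht_mono.
have conn p q : connect (flow_rel S) p q -> p = q \/ (ht p < ht q)%N.
  case/connectP => g; elim: g p => [|p' g IH] p /=; first by left.
  move=> /andP[/and3P[pS p'S cov] path_g] eq.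
  have [->|lt_pp'] := ht_mono p p' pS p'S cov; first exact: IH.
  by right; have [<-|] := IH p' path_g eq; last exact: ltn_trans.
by move=> p q _ _ /andP[/conn[//|lt_pq] /conn[//|/(ltn_trans lt_pq)]]; rewrite ltnn.
Qed.

Lemma partial_matching_card S : partial_matching S -> (#|S| <= #|X|)%N.
Proof.
case=> _ inj; rewrite -(card_in_imset (f := fst) (D := mem S)) ?max_card //.
by move=> p q pS qS eq; apply: (inj p.1) => //; rewrite ?eq !inE eqxx.
Qed.

End Paths.

(** * Invariants of Scythe *)

Section Soundness.
Context {R : pzRingType} {disp : Order.disp_t} {X : finPOrderType disp}.
Context {dim : X -> nat} (F : parametrization R dim).
Hypothesis dim_graded : graded dim.
Implicit Types (s : state F) (x y w z c : X) (l : seq X).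

(** [sound_cur] is the goal. Preserving it uses [sound_terminal], which lets a new pair be added at
    the end of paths only, [sound_height], which bounds path lengths, and [sound_cur_unmarked],
    which identifies the maps out of [x] with the original ones. *)
Record sound s : Prop := Sound {
  sound_cov_alive : forall x y,
    (x, y) \in cov s -> (x \in alive s) && (y \in alive s);
  sound_cov_dim : forall x y, (x, y) \in cov s -> dim y = (dim x).+1;
  sound_cov_unmarked : forall x y, x \in unmarked s -> y \in alive s ->
    ((x, y) \in cov s) = covers x y;
  sound_cur_unmarked : forall x y, x \in unmarked s -> cur s x y = blk F x y;
  sound_cur_eq0 : forall x y, x \in alive s -> y \in alive s ->
    (x, y) \notin cov s -> cur s x y = 0;
  sound_marked : marked s \subset alive s;
  sound_alive : alive s = critical (matching s);
  sound_matching : partial_matching (matching s);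
  sound_compatible : compatible F (matching s);
  (* witnessed by the time at which a pair is reduced *)
  sound_height : exists ht : X * X -> nat,
    (forall p, p \in matching s -> (ht p < #|matching s|)%N) /\
    (forall p q, p \in matching s -> q \in matching s -> covers p.1 q.2 ->
       p = q \/ (ht p < ht q)%N);
  sound_terminal : forall x q, x \in unmarked s -> q \in matching s ->
    ~~ covers x q.2;
  sound_cur : {in alive s &, forall w z,
    cur s w z = morse_blk F (matching s) w z}
}.

Lemma sound_initial : sound (initial F).
Proof.
have in0 (p : X * X) : p \in matching (initial F) = false by rewrite inE.
have dom (p : X * X) : (p \in cov (initial F)) = covers p.1 p.2 by rewrite inE.
split=> //=.
- by move=> x y _; rewrite !inE.
- by move=> x y; rewrite dom; exact: dim_graded.
- by move=> x y _ _; rewrite dom => /blk_notcovers.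
- by apply/setP => x; rewrite !inE; apply/esym/forall_inP => p; rewrite inE.
- by split=> [p|x p q]; rewrite inE.
- by move=> p; rewrite inE.
- by exists (fun=> 0%N); split=> [p|p q]; rewrite inE.
- by move=> x q _; rewrite inE.
move=> w z _ _; rewrite /morse_blk big1 ?addr0 // => J _; rewrite big1 // => g.
rewrite gradient_pathE /flow_path => /andP[/and3P[gn0 g0 _] _].
by case: (tval g) gn0 g0 => //= p g'; rewrite inE.
Qed.

Lemma unmarked_sub s : unmarked s \subset alive s.
Proof. exact: subsetDl. Qed.

Lemma sound_select s c : sound s -> c \in unmarked s -> sound (select s c).
Proof.
move=> [cov_alive cov_dim cov_unm cur_unm cur0 mk al mt cp ht term cu] c_unm.
have sub x : x \in unmarked (select s c) -> x \in unmarked s.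
  by rewrite !inE negb_or => /andP[/andP[_ ->] ->].
split=> //=.
- by move=> x y /sub; exact: cov_unm.
- by move=> x y /sub; exact: cur_unm.
- by rewrite subUset sub1set mk andbT (subsetP (unmarked_sub s)).
- by move=> x q /sub; exact: term.
Qed.

Lemma sound_pop s : sound s -> sound (pop s).
Proof. by case=> *; split. Qed.

Lemma sound_push s l : sound s -> sound (push s l).
Proof. by case=> *; split. Qed.

Lemma sound_upE s x : sound s -> x \in unmarked s ->
  up s x \subset [set y | covers x y].
Proof.
move=> snd x_unm; apply/subsetP => y; rewrite !inE => xy.
have /andP[_ y_al] := sound_cov_alive snd xy.
by rewrite -(sound_cov_unmarked snd).
Qed.

(** * Preservation of the invariants by ReducePair *)

Section Reduce.
Context (s : state F) (x y : X).
Hypothesis snd : sound s.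
Hypothesis y_unm : y \in unmarked s.
Hypothesis xy_match : matchable s x y.

Lemma matchable_down : x \in unmarked s /\ (x, y) \in cov s.
Proof.
have [eq_unm _] := xy_match.
have: x \in unmarked_below s y by rewrite eq_unm set11.
by rewrite in_setI => /andP[+ ->]; rewrite inE.
Qed.

Lemma down_marked w : w \in down s y :\ x -> w \in marked s.
Proof.
have [eq_unm _] := xy_match.
rewrite in_setD1 => /andP[nwx wy]; apply: contraNT nwx => w_unm.
rewrite -in_set1 -eq_unm in_setI wy in_setD w_unm.
by move: wy; rewrite inE => /(sound_cov_alive snd)/andP[].
Qed.

Lemma sound_reduce : sound (reduce_pair s x y).
Proof.
have [x_unm xy_cov] := matchable_down.
have [eq_unm xy_inv] := xy_match.
have [cov_alive cov_dim cov_unm cur_unm cur0 mk al mt cp [ht [ht_lt ht_mono]] term cu] := snd.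
have x_al : x \in alive s by apply: subsetP x_unm; exact: unmarked_sub.
have y_al : y \in alive s by apply: subsetP y_unm; exact: unmarked_sub.
have xy : covers x y by rewrite -cov_unm.
have nmatch z q : z \in alive s -> q \in matching s -> z \in [:: q.1; q.2] -> False.
  by rewrite al inE => /forall_inP H /H /andP[/negPf n1 /negPf n2]; rewrite !inE n1 n2.
have xyN : (x, y) \notin matching s.
  by apply/negP => /(nmatch x _ x_al); apply; rewrite inE eqxx.
have sub z : z \in unmarked (reduce_pair s x y) ->
    [/\ z \in unmarked s, z != x & z != y].
  by rewrite !inE => /and4P[-> -> -> ->].
have alE z : z \in alive (reduce_pair s x y) = [&& z != y, z != x & z \in alive s].
  by rewrite !inE.
have covE w z : (w, z) \in cov (reduce_pair s x y) =
    (((w, z) \in cov s) || ((w \in down s y :\ x) && (z \in up s x :\ y))) &&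
    [&& w != x, w != y, z != x & z != y].
  by rewrite inE /= in_setU in_setX.
have upE z : (z \in up s x) = ((x, z) \in cov s) by rewrite inE.
have downE w : (w \in down s y) = ((w, y) \in cov s) by rewrite inE.
have unm_down w : w \in unmarked s -> w \in down s y :\ x = false.
  by move=> w_unm; apply: contraTF w_unm => /down_marked wm; rewrite inE wm.
have in_match q : q \in matching (reduce_pair s x y) = (q == (x, y)) || (q \in matching s).
  by rewrite in_setU1.
(* Unmarked elements keep their original upper covers, and [x] is the only unmarked one in the
   current [y_-]; this yields terminality with respect to the new pair. *)
have covers_y w : w \in unmarked s -> w != x -> ~~ covers w y.
  move=> w_unm; apply: contraNN => wy; rewrite -in_set1 -eq_unm.
  by rewrite inE w_unm downE cov_unm // wy.
have mt' : partial_matching (matching (reduce_pair s x y)).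
  have [mt_cov mt_inj] := mt; split=> [q|z q q'].
    by rewrite in_match => /orP[/eqP ->|/mt_cov].
  have new r : r \in matching s -> z \in [:: x; y] -> z \in [:: r.1; r.2] -> False.
    by move=> rS; rewrite mem_seq2 => /orP[] /eqP ->; exact: nmatch.
  rewrite !in_match => /orP[/eqP ->|qS] /orP[/eqP ->|q'S] //.
  - by move=> zxy /(new _ q'S zxy).
  - by move=> zq zxy; case: (new _ qS zxy zq).
  - exact: mt_inj.
have card : #|matching (reduce_pair s x y)| = #|matching s|.+1.
  by rewrite cardsU1 xyN.
split.
- move=> w z; rewrite covE !alE => /andP[wz /and4P[-> -> -> ->]] /=.
  case/orP: wz => [/cov_alive //|].
  rewrite !in_setD1 upE downE => /andP[/andP[_ wy] /andP[_ xz]].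
  by have /andP[-> _] := cov_alive _ _ wy; have /andP[_ ->] := cov_alive _ _ xz.
- move=> w z; rewrite covE => /andP[/orP[/cov_dim //|+] _].
  rewrite !in_setD1 upE downE => /andP[/andP[_ /cov_dim wy] /andP[_ /cov_dim ->]].
  by rewrite -wy (cov_dim _ _ xy_cov).
- move=> w z /sub[w_unm nwx nwy]; rewrite alE => /and3P[nzy nzx z_al].
  by rewrite covE unm_down // orbF cov_unm // nzy nzx nwx nwy !andbT.
- move=> w z /sub[w_unm nwx nwy]; rewrite /= /reduced_cur unm_down // andbF.
  exact: cur_unm.
- move=> w z; rewrite !alE => /and3P[nwy nwx w_al] /and3P[nzy nzx z_al].
  rewrite covE nwx nwy nzx nzy !andbT negb_or => /andP[wz /negPf nB].
  by rewrite /= /reduced_cur andbC nB; exact: cur0.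
- apply/subsetP => z z_mk; rewrite alE (subsetP mk) // andbT.
  by apply/andP; split; [move: y_unm|move: x_unm];
    rewrite inE; apply: contraTneq => <-; rewrite z_mk.
- apply/setP => z; rewrite alE al !inE; apply/and3P/forall_inP.
    move=> [nzy nzx /forall_inP z_crit] q; rewrite in_match => /orP[/eqP ->|/z_crit //].
    by rewrite nzx nzy.
  move=> z_crit; have /andP[-> ->] := z_crit (x, y) (setU11 _ _); split=> //.
  by apply/forall_inP => q qS; apply: z_crit; rewrite in_match qS orbT.
- exact: mt'.
- move=> q; rewrite in_match => /orP[/eqP -> /=|/cp //].
  by rewrite -(cur_unm x y).
(* The height of the new pair is the number of earlier reductions; [term] shows that it does not
   flow into an earlier pair. *)
- exists (fun q => if q == (x, y) then #|matching s| else ht q).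
  split=> [q|q q']; rewrite ?in_match ?card.
    by case: eqP => [//|_ /= /ht_lt /ltnW]; rewrite ltnS.
  case: eqP => [->|_]; case: eqP => [-> //|_] //=; first by left.
  - by move=> _ q'S /(negP (term x q' x_unm q'S)).
  - by move=> /ht_lt lt _ _; right.
  - exact: ht_mono.
- move=> w q /sub[w_unm nwx nwy]; rewrite in_match => /orP[/eqP ->|]; last exact: term.
  exact: covers_y.
move=> w z; rewrite !alE => /and3P[nwy nwx w_al] /and3P[nzy nzx z_al].
(* The matching enlarged by [(x, y)] still has at most [#|X|] pairs, so the old one has fewer and
   admits no path of length [#|X|]. *)
have no_long : path_sum F (matching s) w y #|X| = 0.
  apply: path_sum_eq0 ht_lt ht_mono _.
  by rewrite -card; exact: partial_matching_card.
rewrite [matching _]/= morse_blk_setU1 //; last by move=> q; exact: term.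
rewrite -!cu // -!(cur_unm x) // mulmxN mulNmx /= /reduced_cur.
(* Where ReducePair changes nothing, an outer factor of the correction is already zero. *)
case: ifP => // /negbT; rewrite !in_setD1 nwx nzy upE downE negb_and => /orP[] /cur0 -> //;
by rewrite ?mulmx0 ?mul0mx subr0.
Qed.

End Reduce.

Lemma sound_computes_morse s : sound s -> final s -> computes_morse s.
Proof.
move=> snd [_ no_unm]; have [ht [_ ht_mono]] := sound_height snd.
split; [exact: sound_matching | exact: acyclic_height ht_mono |
        exact: sound_compatible | exact: sound_alive |].
by rewrite -(sound_alive snd); exact: sound_cur.
Qed.

(** * Invariants of the queue *)

Definition queued_at_level s : Prop :=
  forall y, y \in queue s -> y \notin marked s /\ dim y = (level s).+1.

(** The second shape is the one just after a selection: [c] has nothing unmarked below it, so it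
    cannot be matched. The bound on [up s c] is recorded for the time estimate, because [sound]
    controls upper covers of unmarked elements only. *)
Record queued s : Prop := Queued {
  queued_uniq : uniq (queue s);
  queued_flagged : {subset queue s <= flagged s};
  queued_shape : queued_at_level s \/
    exists2 c, queue s = [:: c] &
      [/\ c \in marked s, unmarked_below s c = finset.set0
        & up s c \subset [set y | covers c y]]
}.

Lemma queued_pop s y q : queue s = y :: q -> queued s ->
  queued (pop s) /\ queued_at_level (pop s).
Proof.
move=> eq_q [uq fl sh]; have lev : queued_at_level (pop s).
  case: sh => [lev|[c]]; last by rewrite /queued_at_level /= eq_q => -[_ ->].
  by move=> z /= zq; apply: lev; rewrite eq_q in zq *; rewrite inE zq orbT.
split=> //; split; last by left.
- by move: uq; rewrite /= eq_q => /andP[].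
- by move=> z /= zq; apply: fl; rewrite eq_q in zq *; rewrite inE zq orbT.
Qed.

Lemma queued_select s c : minimal_unmarked s c -> sound s ->
  queued (select s c).
Proof.
move=> [c_unm c_min] snd; split=> //=.
  by move=> z; rewrite !inE.
right; exists c => //; split; first exact: setU11.
  apply/setP => x; rewrite in_setI !inE negb_or; apply/negP.
  move=> /and3P[xc /andP[nxc x_mk] x_al]; case/eqP: nxc.
  by apply: c_min; [rewrite inE x_mk|exact: connect1].
exact: sound_upE snd c_unm.
Qed.

Lemma mem_enqueued s A l : enqueued s A l -> forall z,
  (z \in l) = [&& z \in A, z \in unmarked s, z \notin flagged s
               & dim z == (level s).+1].
Proof. by move=> /perm_mem eql z; rewrite eql mem_enum inE. Qed.

Lemma enqueued_uniq s A l : enqueued s A l -> uniq l.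
Proof. by move/perm_uniq->; exact: enum_uniq. Qed.

Lemma queued_push s A l : enqueued s A l -> queued s -> queued_at_level s ->
  queued (push s l) /\ queued_at_level (push s l).
Proof.
move=> enq [uq fl _] lev; have meml := mem_enqueued enq.
have lev' : queued_at_level (push s l).
  move=> z; rewrite /= mem_cat => /orP[/lev //|].
  by rewrite meml => /and4P[_ + _ /eqP ->]; rewrite inE => /andP[].
split=> //; split; last by left.
- rewrite /= cat_uniq uq (enqueued_uniq enq) andbT /=; apply/hasPn => z.
  by rewrite meml => /and4P[_ _ + _]; apply: contra; exact: fl.
- by move=> z; rewrite /= mem_cat in_setU inE => /orP[/fl ->|->] //; rewrite orbT.
Qed.

Lemma matchable_unmarked s x y q : queued s -> queue s = y :: q ->
  y \in alive s -> matchable s x y ->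
  y \in unmarked s /\ dim y = (level s).+1.
Proof.
move=> [_ _ sh] eq_q y_al [unm _]; case: sh => [lev|[c]].
  have [] := lev y; first by rewrite eq_q inE eqxx.
  by rewrite inE y_al => -> ->.
rewrite eq_q => -[<- _] [_ + _]; rewrite unm => /setP/(_ x).
by rewrite !inE eqxx.
Qed.

Lemma step_sound (T : matrix_routines R) s t m s' : step T s t m s' ->
  sound s -> queued s -> sound s' /\ queued s'.
Proof.
case=> [c _ c_min|y q eq_q _|y q l eq_q _ _ enq|
        x y q l l' eq_q y_al xy_match enq enq'] snd qd.
- by split; [apply: sound_select => //; case: c_min | exact: queued_select].
- by split; [exact: sound_pop | case: (queued_pop eq_q qd)].
- have [qd1 lev1] := queued_pop eq_q qd.
  by split; [exact/sound_push/sound_pop | case: (queued_push enq qd1 lev1)].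
have [y_unm _] := matchable_unmarked qd eq_q y_al xy_match.
have [qd1 lev1] := queued_pop eq_q qd; have [qd2 lev2] := queued_push enq qd1 lev1.
split; first by apply/sound_push/sound_reduce => //; exact/sound_push/sound_pop.
have [] := queued_push enq' _ lev2; last by [].
by case: qd2 => *; split=> //; left.
Qed.

Lemma run_sound (T : matrix_routines R) t m s : run T t m s ->
  sound s /\ queued s.
Proof.
elim=> [|{}t {}m {}s t' m' s' _ [snd qd] st]; last exact: step_sound st snd qd.
by split; [exact: sound_initial | split=> //; left].
Qed.

End Soundness.

(** * Termination *)

Lemma select_progress_arith (n b f : nat) :
  (0 < n)%N -> (b + (n - 1) + 1 < n.+1 + b + (n - f) + 0)%N.
Proof. lia. Qed.

Section Termination.
Context {R : pzRingType} {disp : Order.disp_t} {X : finPOrderType disp}.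
Context {dim : X -> nat} (T : matrix_routines R) (F : parametrization R dim).
Implicit Types (s : state F) (x y w z c : X) (l : seq X).

(** A selection loses one unmarked element, worth [#|X|.+1], and regains at most [#|X|] from the
    cleared flags and the new queue together. Enqueuing trades unflagged elements for queue entries,
    and each dequeuing then lowers the sum. *)
Definition progress s : nat :=
  #|unmarked s| * #|X|.+1 + (#|X| - #|flagged s|) + size (queue s).

Lemma progress_pop s y q : queue s = y :: q ->
  (progress (pop s) < progress s)%N.
Proof. by move=> eq_q; rewrite /progress /= eq_q /= addnS. Qed.

Lemma progress_push s A l : enqueued s A l -> progress (push s l) = progress s.
Proof.
move=> enq; have meml := mem_enqueued enq.
have card : #|flagged (push s l)| = (#|flagged s| + size l)%N.
  rewrite cardsU disjoint_setI0 ?cards0 ?subn0.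
    by rewrite cardsE (card_uniqP (enqueued_uniq enq)).
  rewrite disjoint_sym disjoint_subset; apply/subsetP => z.
  by rewrite !inE meml => /and4P[].
have : (#|flagged s| + size l <= #|X|)%N by rewrite -card max_card.
rewrite /progress card /= size_cat.
have -> : unmarked (push s l) = unmarked s by [].
lia.
Qed.

Lemma progress_reduce s x y : (progress (reduce_pair s x y) <= progress s)%N.
Proof.
rewrite /progress leq_add2r leq_add2r leq_mul2r; apply/orP; right.
apply/subset_leq_card/subsetP => z; rewrite !inE.
by move=> /and4P[-> _ _ ->].
Qed.

Lemma progress_select s c : queue s = [::] -> c \in unmarked s ->
  (progress (select s c) < progress s)%N.
Proof.
move=> eq_q c_unm; rewrite /progress eq_q /= cards1.
have -> : unmarked (select s c) = unmarked s :\ c.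
  by apply/setP => z; rewrite !inE negb_or andbA.
have : (#|[set c]| <= #|X|)%N by exact: max_card.
rewrite cards1.
rewrite (cardsD1 c (unmarked s)) c_unm add1n mulSn.
by move=> n_gt0; apply: select_progress_arith.
Qed.

Lemma progress_step s t m s' : step T s t m s' ->
  (progress s' < progress s)%N.
Proof.
case=> [c eq_q [c_unm _]|y q eq_q _|y q l eq_q _ _ enq|
        x y q l l' eq_q _ _ enq enq'].
- exact: progress_select.
- exact: progress_pop eq_q.
- by rewrite (progress_push enq); exact: progress_pop eq_q.
rewrite (progress_push enq') (leq_ltn_trans (progress_reduce _ _ _)) //.
by rewrite (progress_push enq); exact: progress_pop eq_q.
Qed.

(** An unmarked element of least dimension will do, since every current cover raises the
    dimension. *)
Lemma minimal_unmarked_exists s : sound s -> unmarked s != finset.set0 ->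
  exists c, minimal_unmarked s c.
Proof.
move=> snd /set0Pn[c0 c0_unm].
have [c c_unm c_min] := arg_minnP dim c0_unm.
exists c; split=> // x x_unm /connectP[p].
case: p => [|z p] //= /andP[xz zp] eq_c; have := c_min x x_unm.
have dim_le : forall p z, path [rel u v | (u, v) \in cov s] z p ->
    (dim z <= dim (last z p))%N.
  elim=> //= v p' IH u /andP[/(sound_cov_dim snd) dim_v /IH].
  by rewrite dim_v; apply: leq_trans.
by move: (dim_le p z zp); rewrite -eq_c (sound_cov_dim snd xz); lia.
Qed.

Lemma exists_enqueued s A : exists l, enqueued s A l.
Proof. by eexists; exact: perm_refl. Qed.

Lemma sound_progresses s : sound s -> final s \/ exists t m s', step T s t m s'.
Proof.
move=> snd; case eq_q : (queue s) => [|y q].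
  have [no_unm|unm] := eqVneq (unmarked s) finset.set0; first by left.
  right; have [c c_min] := minimal_unmarked_exists snd unm.
  by do 3!eexists; exact: StepSelect eq_q c_min.
right; have [y_al|y_dead] := boolP (y \in alive s); last first.
  by do 3!eexists; exact: StepRemoved eq_q y_dead.
have [[x xy]|no_match] := boolp.pselect (exists x, matchable s x y).
  have [l enq] := exists_enqueued (pop s) (up s x :\ y).
  have [l' enq'] := exists_enqueued (reduce_pair (push (pop s) l) x y) (up s y).
  by do 3!eexists; exact: StepReduce eq_q y_al xy enq enq'.
have [l enq] := exists_enqueued (pop s) (up s y).
by do 3!eexists; exact: StepKeep eq_q y_al no_match enq.
Qed.

Lemma scythe_terminates : graded dim -> terminates T F.
Proof.
move=> dim_graded; split; last first.
  by move=> t m s /(run_sound dim_graded)[snd _]; exact: sound_progresses.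
suff acc k s : (progress s < k)%N ->
    Acc (fun s' s => exists t m, step T s t m s') s by exact: acc (ltnSn _).
elim: k s => [|k IH] s lt_s; first by rewrite ltn0 in lt_s.
apply: Acc_intro => s' [t [m st]]; apply: IH.
exact: leq_trans (progress_step st) lt_s.
Qed.

End Termination.

(** * Time *)

Section TimeArithmetic.
Local Open Scope nat_scope.

(** With [q = n * p * B], the search costs at most [4q] and the new budget at most [4q(a + 2) + 2q].
    The sum [14q + 4qa] is at most [14q(a + 1)], which the growth from [A] to [A'] provides. *)
Lemma select_arith n p B a A A' : 0 < n -> 0 < p -> 0 < B -> A + a.+1 <= A' ->
  (1 + n + n * p + n) + (n * (4 * B * p * (1 + a.+1)) + n * p + n)
    + 14 * (n * p * B) * (1 + A) <= 14 * (n * p * B) * (1 + A').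
Proof.
move=> n0 p0 B0 leA.
have h1 : n <= n * p by rewrite leq_pmulr.
have h2 : n * p <= n * p * B by rewrite leq_pmulr.
have : 14 * (n * p * B) * (1 + A + a.+1) <= 14 * (n * p * B) * (1 + A').
  by rewrite leq_mul2l -addnA leq_add2l leA orbT.
have -> : n * (4 * B * p * (1 + a.+1)) = 4 * (n * p * B) * (1 + a.+1) by lia.
have h3 : a <= n * p * B * a by rewrite leq_pmull // !muln_gt0 n0 p0.
move: (n * p * B) (n * p) h1 h2 h3 => q r; nia.
Qed.

Lemma keep_arith a p B D dn u : 0 < p -> 0 < B -> dn <= a + D -> u <= p ->
  1 + (dn + B) + u <= 4 * B * p * (1 + a) + D.
Proof.
move=> p0 B0 ledn leu; have h1 : p <= B * p by rewrite leq_pmull.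
have h2 : B <= B * p by rewrite leq_pmulr.
have h3 : a <= B * p * a by rewrite leq_pmull // muln_gt0 B0.
move: (B * p) h1 h2 h3 => q; nia.
Qed.

Lemma reduce_arith a A p B Dx Dy u v dx dy : 0 < p -> 0 < B -> a <= A ->
    u <= p -> v <= p -> dx <= A + Dx -> dy <= a + Dy ->
  u + (1 + p * (a * (4 * B)) + u + dx + v + dy) <=
  (9 * (p * B) * (1 + A) + Dx) + (9 * (p * B) * (1 + A) + Dy).
Proof.
move=> p0 B0 leaA leu lev ledx ledy.
have h1 : p <= p * B by rewrite leq_pmulr.
have h2 : A <= p * B * A by rewrite leq_pmull // muln_gt0 p0.
have h3 : p * B * a <= p * B * A by rewrite leq_mul2l leaA orbT.
have -> : p * (a * (4 * B)) = 4 * (p * B * a) by lia.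
move: (p * B * a) (p * B) h1 h2 h3 => r q; nia.
Qed.

(** As [A >= 1], the bound [1 + A <= 2A] turns the factors 14 and 9 into 46, and [n * p] adds at
    most one more. *)
Lemma total_arith n p B A t : 0 < p -> 0 < B -> 0 < A ->
  t <= 14 * (n * p * B) * (1 + A) + (n * (9 * (p * B) * (1 + A)) + n * p) ->
  t <= 48 * (n * p * A * B).
Proof.
move=> p0 B0 A0 /leq_trans -> //.
have h1 : n * p <= n * p * B by rewrite leq_pmulr.
have h2 : n * p * B <= n * p * B * A by rewrite leq_pmulr.
have -> : n * p * A * B = n * p * B * A by lia.
have -> : n * (9 * (p * B) * (1 + A)) = 9 * (n * p * B) + 9 * (n * p * B * A) by lia.
have -> : 14 * (n * p * B) * (1 + A) = 14 * (n * p * B) + 14 * (n * p * B * A) by lia.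
lia.
Qed.

End TimeArithmetic.

Lemma run_arith t b al t' b' al' : (t + b <= al)%N ->
  (t' + b' + al <= b + al')%N -> (t + t' + b' <= al')%N.
Proof. lia. Qed.

Lemma initial_arith n p B A : (0 < B)%N ->
  (n * (4 * B * p * (1 + 0)) + n * p <= 14 * (n * p * B) * (1 + A))%N.
Proof.
move=> B0; have h : (n * p <= n * p * B)%N by rewrite leq_pmulr.
have -> : (n * (4 * B * p * (1 + 0)) = 4 * (n * p * B))%N by lia.
move: (n * p * B)%N h => q; nia.
Qed.

Lemma combine_arith t w u r b bm bs al rd :
  (t = w + u + r)%N -> (bs + w <= b)%N -> (u + r <= rd)%N ->
  (bm <= bs)%N -> (t + bm + al <= b + (al + rd))%N.
Proof. lia. Qed.

Section Time.
Context {R : pzRingType} {disp : Order.disp_t} {X : finPOrderType disp}.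
Context {dim : X -> nat} (T : matrix_routines R) (F : parametrization R dim).
Hypothesis dim_graded : graded dim.
Implicit Types (s : state F) (x y w z c : X) (l : seq X).
Local Open Scope nat_scope.

Local Notation n := #|X|.
Local Notation p := (max_upper_covers X).
Local Notation d := (max_rank F).

Definition nlower y : nat := #|[set x | covers x y]|.

Lemma sum_nlower : \sum_y nlower y <= n * p.
Proof.
rewrite /nlower; under eq_bigr do rewrite -sum1dep_card.
rewrite (exchange_big_dep predT) //= -sum_nat_const; apply: leq_sum => x _.
by rewrite sum1dep_card; exact: (leq_bigmax x).
Qed.

Definition nmarked s k : nat := #|[set x in marked s | dim x == k]|.

Definition sqr_marked s : nat := \sum_(k < (\max_(x : X) dim x).+1) nmarked s k ^ 2.

Lemma dim_lt x : dim x < (\max_(x : X) dim x).+1.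
Proof. by rewrite ltnS; exact: (leq_bigmax x). Qed.

Lemma nmarked_le s k : nmarked s k <= sqr_marked s.
Proof.
have [lt_k|le_k] := ltnP k (\max_(x : X) dim x).+1.
  rewrite /sqr_marked (bigD1 (Ordinal lt_k)) //= (leq_trans _ (leq_addr _ _)) //.
  by case: (nmarked s k) => // a; rewrite leq_pmulr.
rewrite /nmarked eq_card0 // => x; rewrite !inE.
by have := dim_lt x; case: eqVneq => [->|]; rewrite ?andbF // ltnNge le_k.
Qed.

(** Reductions may have created covers out of marked elements, so these are only counted by
    dimension; the unmarked lower covers are original ones. *)
Lemma card_down s y : sound s -> #|down s y| <= nmarked s (dim y).-1 + nlower y.
Proof.
move=> snd; rewrite (leq_trans _ (leq_card_setU _ _)) //.
apply/subset_leq_card/subsetP => x; rewrite in_setU !inE => xy.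
have /andP[x_al y_al] := sound_cov_alive snd xy.
rewrite (sound_cov_dim snd xy) eqxx andbT.
have [//|x_unm] := boolP (x \in marked s).
by rewrite -(sound_cov_unmarked snd) // inE x_unm.
Qed.

Lemma card_up_le s x : up s x \subset [set y | covers x y] -> #|up s x| <= p.
Proof. by move=> /subset_leq_card/leq_trans -> //; exact: (leq_bigmax x). Qed.

Lemma card_up s x : sound s -> x \in unmarked s -> #|up s x| <= p.
Proof. by move=> snd x_unm; exact/card_up_le/sound_upE. Qed.

Lemma rank_le x : rk F x <= d.
Proof. exact: (leq_bigmax x). Qed.

(** * Amortized cost, with [B] bounding each matrix operation *)

Section Bounds.
Context (B : nat).
Hypothesis mul_B : forall (a b c : nat) (A1 : 'M[R]_(a, b)) (A2 : 'M[R]_(b, c)),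
  a <= d -> b <= d -> c <= d -> mul_time T A1 A2 <= B.
Hypothesis inv_B : forall a b (A : 'M[R]_(a, b)),
  a <= d -> b <= d -> inv_time T A <= B.
Hypothesis B_gt0 : 0 < B.
Hypothesis p_gt0 : 0 < p.

Lemma test_time_le s y : test_time T s y <= #|down s y| + B.
Proof.
rewrite leq_add2l; case: eqP => [/eqP/cards1P[x ->]|_]; last first.
  by rewrite big_pred0 // => x; rewrite andbF.
by rewrite big_mkcondr /= big_set1 inv_B ?rank_le.
Qed.

Lemma test_time_eq s y : unmarked_below s y = finset.set0 ->
  test_time T s y = #|down s y|.
Proof.
move=> eq0; rewrite /test_time eq0 cards0 [X in _ + X]big_pred0 ?addn0 //=.
by move=> x; rewrite andbF.
Qed.

Lemma reduce_time_le s x y a : #|down s y :\ x| <= a -> #|up s x| <= p ->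
  reduce_time T s x y <=
    1 + p * (a * (4 * B)) + #|up s x| + #|down s x| + #|up s y| + #|down s y|.
Proof.
move=> le_a le_p; rewrite /reduce_time !leq_add2r leq_add2l.
apply: (@leq_trans (\sum_(z in up s x :\ y) a * (4 * B))).
  apply: leq_sum => z _; apply: (@leq_trans (\sum_(w in down s y :\ x) 4 * B)).
    apply: leq_sum => w _.
    (* The difference has as many entries as the second product, whose time includes writing them.
       With the unit step and two products this makes [4 * B]. *)
    have out : rk F w * rk F z <= B.
      rewrite (leq_trans (mul_time_output T (cur s w y *m inverse (cur s x y))
                            (cur s x z))) //.
      by rewrite mul_B ?rank_le.
    have m1 : mul_time T (cur s w y) (inverse (cur s x y)) <= B by rewrite mul_B ?rank_le.
    have m2 : mul_time T (cur s w y *m inverse (cur s x y)) (cur s x z) <= B.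
      by rewrite mul_B ?rank_le.
    by rewrite 3!mulSn mul1n !addnA !leq_add.
  by rewrite sum_nat_const leq_mul2r le_a orbT.
rewrite sum_nat_const leq_mul2r; apply/orP; right.
by rewrite (leq_trans _ le_p) // subset_leq_card // subsetDl.
Qed.

(** The price of dequeuing [y], reductions excluded: the marked part of [y_-] lies in dimension
    [level s], and [nlower y] pays for the unmarked part. *)
Definition work s y : nat := 4 * B * p * (1 + nmarked s (level s)) + nlower y.

(* What the rest of the current round may still cost: [y] is charged when it is
   dequeued, and the selected element is charged separately. *)
Definition budget s : nat :=
  \sum_(y | (y \notin flagged s) || (y \in queue s)) work s y
    + n * has (mem (marked s)) (queue s).

(** The share of one removed element in the price of its ReducePair call. *)
Definition reduction s x : nat := 9 * (p * B) * (1 + sqr_marked s) + nlower x.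

(** The first term pays for the initial budget, the selections and the budgets they open, the second
    for the reductions made so far. *)
Definition allowance s : nat :=
  14 * (n * p * B) * (1 + sqr_marked s) + \sum_(x | x \notin alive s) reduction s x.

Lemma no_marked_queue s : queued_at_level s -> has (mem (marked s)) (queue s) = false.
Proof.
by move=> lev; apply/hasP => -[y /lev[y_unm _]] /=; apply/negP.
Qed.

Lemma leq_sum_pred (P Q : pred X) f : (forall x, P x -> Q x) ->
  \sum_(x | P x) f x <= \sum_(x | Q x) f x.
Proof.
move=> sub; rewrite big_mkcond [leqRHS]big_mkcond; apply: leq_sum => x _ /=.
by case: ifP => // /sub ->.
Qed.

Lemma budget_pop s y q : queue s = y :: q -> queued s ->
  budget (pop s) + work s y + n * (y \in marked s) <= budget s.
Proof.
move=> eq_q qd; have [_ lev] := queued_pop eq_q qd.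
have [uq fl _] := qd; rewrite eq_q /= in uq; have /andP[ynq _] := uq.
rewrite /budget (no_marked_queue lev) muln0 addn0 leq_add //; last first.
  by rewrite eq_q /=; case: (y \in marked s); rewrite ?muln0.
rewrite [leqRHS](bigD1 y) /=; last by rewrite eq_q inE eqxx orbT.
rewrite addnC leq_add2l; apply: leq_sum_pred => z /=; rewrite eq_q inE /=.
have y_fl : y \in flagged s by apply: fl; rewrite eq_q inE eqxx.
move=> /orP[zn|zq]; first by rewrite zn; apply: contraNneq zn => ->.
by rewrite zq !orbT /=; apply: contraNneq ynq => <-.
Qed.

(** The elements put in the queue were unflagged, so the budget already counted them. *)
Lemma budget_push s A l : enqueued s A l -> queued s -> queued_at_level s ->
  budget (push s l) <= budget s.
Proof.
move=> enq qd lev; have [_ lev'] := queued_push enq qd lev.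
rewrite /budget (no_marked_queue lev') muln0 addn0 (leq_trans _ (leq_addr _ _)) //.
apply: leq_sum_pred => z; rewrite /= in_setU inE negb_or mem_cat.
case/or3P => [/andP[-> //]|->|]; first by rewrite orbT.
by rewrite (mem_enqueued enq) => /and4P[_ _ ->].
Qed.

Lemma nmarked_select s c k : c \notin marked s ->
  nmarked (select s c) k = (k == dim c) + nmarked s k.
Proof.
move=> c_unm; rewrite /nmarked; have [->|nk] := eqVneq k (dim c).
  rewrite (cardsD1 c) !inE eqxx /= eqxx; congr (_ + _); apply: eq_card => x.
  by rewrite !inE; case: eqVneq => [->|]; rewrite // (negPf c_unm).
rewrite add0n; apply: eq_card => x; rewrite !inE.
by case: eqVneq => [->|//]; rewrite eq_sym (negPf nk) (negPf c_unm).
Qed.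

Lemma sqr_marked_select s c : c \notin marked s ->
  sqr_marked s + (nmarked s (dim c)).+1 <= sqr_marked (select s c).
Proof.
move=> c_unm; rewrite /sqr_marked.
rewrite (bigD1 (Ordinal (dim_lt c))) //= [leqRHS](bigD1 (Ordinal (dim_lt c))) //=.
rewrite addnAC leq_add //; first by rewrite nmarked_select // eqxx; nia.
by apply: leq_sum => k _; rewrite leq_exp2r // nmarked_select // leq_addl.
Qed.

(** Amortization: a selection is paid for by growth of the allowance, plain dequeuing by the drop of
    the budget, and a reduction by both. *)
Lemma step_time s t m s' : step T s t m s' -> sound s -> queued s ->
  t + budget s' + allowance s <= budget s + allowance s'.
Proof.
case=> [c eq_q c_min|y q eq_q _|y q l eq_q y_al _ enq|
        x y q l l' eq_q y_al xy_match enq enq'] snd qd.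
- have [c_unm _] := c_min; have c_nmk : c \notin marked s.
    by move: c_unm; rewrite inE => /andP[].
  have n_gt0 : 0 < n by apply/card_gt0P; exists c.
  have leA := sqr_marked_select c_nmk.
  have sel : select_time s <= 1 + n + n * p + n.
    rewrite !leq_add // ?max_card // (leq_trans (n := \sum_(x : X) p)) //.
      rewrite big_mkcond leq_sum // => x _; case: ifP => //; exact: card_up.
    by rewrite sum_nat_const.
  have bud : budget (select s c) <= n * (4 * B * p * (1 + (nmarked s (dim c)).+1)) + n * p + n.
    rewrite /budget leq_add //; last by rewrite -[leqRHS]muln1 leq_mul2l leq_b1 orbT.
    rewrite (leq_trans (leq_sum_pred (Q := predT) _ _)) // /work big_split /=.
    by rewrite sum_nat_const nmarked_select // eqxx leq_add2l sum_nlower.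
  have sum : \sum_(x | x \notin alive s) reduction s x <=
      \sum_(x | x \notin alive (select s c)) reduction (select s c) x.
    apply: leq_sum => x _; rewrite leq_add2r leq_mul2l leq_add2l.
    by rewrite (leq_trans (leq_addr _ _) leA) orbT.
  rewrite (leq_trans _ (leq_addl _ _)) // /allowance addnA leq_add //.
  rewrite (leq_trans _ (select_arith n_gt0 p_gt0 B_gt0 leA)) //.
  by rewrite leq_add2r leq_add.
- rewrite leq_add2r (leq_trans _ (budget_pop eq_q qd)) //.
  rewrite (leq_trans _ (leq_addr _ _)) // addnC leq_add2l /work.
  by rewrite (leq_trans _ (leq_addr _ _)) // !muln_gt0 B_gt0 p_gt0.
- have [qd1 lev1] := queued_pop eq_q qd.
  have bud : budget (push (pop s) l) <= budget (pop s) by exact: budget_push enq _ _.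
  rewrite leq_add2r (leq_trans _ (budget_pop eq_q qd)) // -[leqRHS]addnA addnC leq_add //.
  have [_ _ [lev|[c]]] := qd.
    have [y_nmk dim_y] : y \notin marked s /\ dim y = (level s).+1.
      by apply: lev; rewrite eq_q inE eqxx.
    rewrite (negPf y_nmk) muln0 addn0.
    have le_down := card_down y snd; rewrite dim_y /= in le_down.
    have y_unm : y \in unmarked s by rewrite inE y_nmk.
    rewrite (leq_trans _ (keep_arith p_gt0 B_gt0 le_down (card_up snd y_unm))) //.
    by rewrite leq_add2r leq_add2l test_time_le.
  (* Here the dequeued element is the selected one: nothing is inverted, and the separate summand
     [n] of the budget pays for searching [y_-]. *)
  rewrite eq_q => -[<- _] [y_mk unm0 le_up]; rewrite y_mk muln1 test_time_eq //.
  rewrite addnAC leq_add ?max_card //.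
  rewrite (leq_trans _ (leq_addr _ _)) // (leq_trans (n := 1 + p)) //.
    by rewrite leq_add2l card_up_le.
  by clear -p_gt0 B_gt0; move: p p_gt0 (nmarked _ _) => k k0 a; nia.
have [y_unm dim_y] := matchable_unmarked qd eq_q y_al xy_match.
have [x_unm xy_cov] := matchable_down xy_match.
have x_al : x \in alive s by apply: subsetP x_unm; exact: unmarked_sub.
have [qd1 lev1] := queued_pop eq_q qd; have [qd2 lev2] := queued_push enq qd1 lev1.
have nxy : x != y.
  by apply/eqP => eq_xy; move: (sound_cov_dim snd xy_cov); rewrite eq_xy => /n_Sn.
have qd3 : queued (reduce_pair (push (pop s) l) x y) by case: qd2 => *; split=> //; left.
have all' : allowance (push (reduce_pair (push (pop s) l) x y) l') =
    allowance s + (reduction s x + reduction s y).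
  rewrite /allowance -addnA; congr (_ + _).
  rewrite (bigD1 x) /=; last by rewrite !inE eqxx /= andbF.
  rewrite (bigD1 y) /=; last by rewrite !inE eqxx eq_sym.
  rewrite addnA addnC; congr (_ + _); apply: eq_bigl => z.
  rewrite !inE; case: eqVneq => [->|_]; rewrite ?y_al ?andbF //=.
  by case: eqVneq => [->|_]; rewrite ?x_al ?andbF ?andbT.
rewrite all'.
(* [work s y] pays for the test and for enqueuing [y_+]; the two [reduction] terms pay for enqueuing
   [x_+] and for ReducePair. *)
apply: (@combine_arith _ (1 + test_time T s y + #|up s y|) #|up s x|
         (reduce_time T s x y) _ _ (budget (pop s))).
- by rewrite addnAC; congr (_ + _); rewrite addnAC.
- rewrite (leq_trans _ (leq_trans (leq_addr _ _) (budget_pop eq_q qd))) // leq_add2l.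
  have le_down := card_down y snd; rewrite dim_y /= in le_down.
  rewrite (leq_trans _ (keep_arith p_gt0 B_gt0 le_down (card_up snd y_unm))) //.
  by rewrite leq_add2r leq_add2l test_time_le.
- have le_down : #|down s y :\ x| <= nmarked s (level s).
    apply/subset_leq_card/subsetP => w w_down; rewrite inE.
    rewrite (down_marked snd xy_match) //=; move: w_down; rewrite !inE => /andP[_].
    by move/(sound_cov_dim snd); rewrite dim_y => -[->].
  have le_dy := card_down y snd; rewrite dim_y /= in le_dy.
  have le_dx : #|down s x| <= sqr_marked s + nlower x.
    by rewrite (leq_trans (card_down x snd)) // leq_add2r nmarked_le.
  have le_ux := card_up snd x_unm; have le_uy := card_up snd y_unm.
  apply: leq_trans (reduce_arith p_gt0 B_gt0 (nmarked_le s (level s)) le_ux le_uy le_dx le_dy).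
  by rewrite leq_add2l reduce_time_le.
by rewrite (leq_trans (budget_push enq' qd3 lev2)) // (budget_push enq).
Qed.

Lemma run_time t m s : run T t m s -> t + budget s <= allowance s.
Proof.
elim=> [|{}t {}m {}s t' m' s' rn le_t st].
  rewrite add0n /budget /= muln0 addn0 (leq_trans _ (leq_addr _ _)) //.
  rewrite (leq_trans (leq_sum_pred (Q := predT) _ _)) // /work big_split /=.
  rewrite sum_nat_const.
  have -> : nmarked (initial F) 0 = 0.
    by rewrite /nmarked eq_card0 // => x; rewrite !inE.
  rewrite (leq_trans (leq_add (leqnn _) sum_nlower)) //.
  exact: initial_arith.
have [snd qd] := run_sound dim_graded rn.
exact: run_arith (step_time st snd qd).
Qed.

(** This serves to make [sqr_marked s] positive in a final state; the second alternative describes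
    the time before the first selection. *)
Lemma run_marked t m s : run T t m s ->
  marked s != finset.set0 \/ (queue s = [::] /\ unmarked s = [set: X]).
Proof.
elim=> [|{}t {}m {}s t' m' s' _ IH st].
  by right; split=> //; apply/setP => x; rewrite !inE.
have [c _ _|y q eq_q _|y q l eq_q _ _ _|x y q l l' eq_q _ _ _ _] := st.
- by left; apply/set0Pn; exists c; exact: setU11.
all: by case: IH => [IH|[]]; [left|rewrite eq_q].
Qed.

Lemma final_time t m s : run T t m s -> final s ->
  t <= 48 * (n * p * sum_sqr_critical (dim := dim) (matching s) * B).
Proof.
move=> rn [_ no_unm]; have [snd _] := run_sound dim_graded rn.
have eq_mk : marked s = critical (matching s).
  rewrite -(sound_alive snd); apply/eqP; rewrite eqEsubset (sound_marked snd) /=.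
  by rewrite -setD_eq0; apply/eqP.
have -> : sum_sqr_critical (dim := dim) (matching s) = sqr_marked s.
  by rewrite /sqr_marked /nmarked eq_mk.
apply: total_arith => //.
  have [/set0Pn[c c_mk]|[_ all_unm]] := run_marked rn.
    rewrite (leq_trans _ (nmarked_le s (dim c))) //.
    by apply/card_gt0P; exists c; rewrite inE c_mk eqxx.
  (* A final state with everything unmarked forces [X] to be empty, against [p_gt0]. *)
  move: p_gt0; rewrite /max_upper_covers big_pred0 // => x.
  by have := in_setT x; rewrite -all_unm no_unm inE.
apply: leq_trans (leq_trans (leq_addr _ _) (run_time rn)) _.
rewrite leq_add2l (leq_trans (leq_sum_pred (Q := predT) _ _)) // big_split /=.
by rewrite sum_nat_const leq_add2l sum_nlower.
Qed.

End Bounds.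
End Time.

(** * Space *)

(** In units of [n ^ 2 * d ^ 2], the elements, the queue and the flags count once each, the covers
    with their matrices twice, and the matching twice. *)
Lemma storage_arith n d c q f : (0 < d)%N ->
  (c <= n * n * (1 + d ^ 2))%N -> (q <= n)%N -> (f <= n)%N ->
  forall mt, (mt <= n * n)%N -> (n + c + q + f + 2 * mt <= 7 * (n ^ 2 * d ^ 2))%N.
Proof.
move=> d0 lec leq lef mt lemt.
have hn : (n <= n * n)%N by case: n {lec leq lef lemt} => // n; rewrite leq_pmulr.
have h : (n * n <= n * n * d ^ 2)%N by rewrite leq_pmulr // expn_gt0 d0.
rewrite mulnDr muln1 in lec; rewrite -(mulnn n).
by move: (n * n * d ^ 2)%N (n * n)%N h hn lec lemt => N r; lia.
Qed.

Section Space.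
Context {R : pzRingType} {disp : Order.disp_t} {X : finPOrderType disp}.
Context {dim : X -> nat} (T : matrix_routines R) (F : parametrization R dim).
Hypothesis dim_graded : graded dim.
Implicit Types (s : state F) (x y w z c : X) (l : seq X).
Local Open Scope nat_scope.

Local Notation n := #|X|.
Local Notation d := (max_rank F).

Context (kappa : nat).
Hypothesis d_gt0 : 0 < d.
Hypothesis mul_kappa : forall (a b c : nat) (A1 : 'M[R]_(a, b)) (A2 : 'M[R]_(b, c)),
  a <= d -> b <= d -> c <= d -> mul_space T A1 A2 <= kappa * d ^ 2.
Hypothesis inv_kappa : forall (a b : nat) (A : 'M[R]_(a, b)),
  a <= d -> b <= d -> inv_space T A <= kappa * d ^ 2.

Lemma block_size x y : rk F x * rk F y <= d ^ 2.
Proof. by rewrite -mulnn leq_mul ?rank_le. Qed.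

Lemma storage_le s : queued s -> storage s <= 7 * (n ^ 2 * d ^ 2).
Proof.
move=> qd; apply: storage_arith => //.
- rewrite -card_prod -sum_nat_const big_mkcond; apply: leq_sum => q _.
  by case: ifP => // _; rewrite leq_add2l block_size.
- by rewrite -(card_uniqP (queued_uniq qd)) max_card.
- exact: max_card.
- by rewrite -card_prod max_card.
Qed.

Lemma test_space_le s y : test_space T s y <= (1 + kappa) * d ^ 2.
Proof.
rewrite /test_space; case: eqP => [/eqP/cards1P[x ->]|_]; last first.
  by rewrite big_pred0 // => x; rewrite andbF.
rewrite big_mkcondr /= big_set1 mulnDl mul1n.
by rewrite leq_add ?block_size ?inv_kappa ?rank_le.
Qed.

Lemma reduce_space_le s x y : reduce_space T s x y <= 3 * ((1 + kappa) * d ^ 2).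
Proof.
have [b i m] : [/\ forall u v, rk F u * rk F v <= d ^ 2,
    inv_space T (cur s x y) <= kappa * d ^ 2 &
    forall w z, mul_space T (cur s w y) (inverse (cur s x y)) +
      mul_space T (cur s w y *m inverse (cur s x y)) (cur s x z) <=
      2 * (kappa * d ^ 2)].
  split; [exact: block_size | by rewrite inv_kappa ?rank_le | move=> w z].
  by rewrite mulSn mul1n leq_add ?mul_kappa ?rank_le.
rewrite /reduce_space mulSn leq_add //; first by rewrite mulnDl mul1n leq_add.
apply/bigmax_leqP => z _; apply/bigmax_leqP => w _.
rewrite -addnA mulnDl mul1n mulnDr leq_add //.
by rewrite mulSn mul1n leq_add.
Qed.

Lemma step_space s t m s' : step T s t m s' ->
  m <= (5 + 4 * kappa) * (n ^ 2 * d ^ 2).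
Proof.
have card_gt0 y : 0 < n ^ 2 by rewrite expn_gt0; apply/orP; left; apply/card_gt0P; exists y.
have scale y k : k <= 4 * ((1 + kappa) * d ^ 2) ->
    k <= (5 + 4 * kappa) * (n ^ 2 * d ^ 2).
  move/leq_trans; apply; rewrite mulnA leq_mul ?leq_pmull // ?(card_gt0 y) //.
  by rewrite mulnDr muln1 leq_add2r.
case=> [c _ _|y q _ _|y q l _ _ _ _|x y q l l' _ _ _ _ _] //.
- rewrite /select_space (@leq_trans (1 * (n ^ 2 * d ^ 2))) //.
    rewrite mul1n -mulnn -mulnA leq_pmulr // muln_gt0 expn_gt0 d_gt0 andbT.
    by apply/card_gt0P; exists c.
  by rewrite leq_mul.
- by apply: (scale y); rewrite (leq_trans (test_space_le _ _)) // leq_pmull.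
apply: (scale y); rewrite (mulnDl 1 3) mul1n leq_add //.
  exact: test_space_le.
exact: reduce_space_le.
Qed.

(** The constant is 7 for the old state, 7 for the new one, and [5 + 4 * kappa] for the working
    space of the step. *)
Lemma run_space t m s : run T t m s ->
  m <= (19 + 4 * kappa) * (n ^ 2 * d ^ 2).
Proof.
have sum : (19 + 4 * kappa) * (n ^ 2 * d ^ 2) =
    7 * (n ^ 2 * d ^ 2) + 7 * (n ^ 2 * d ^ 2) + (5 + 4 * kappa) * (n ^ 2 * d ^ 2).
  by rewrite -!mulnDl.
elim=> [|{}t {}m {}s t' m' s' rn le_m st].
  rewrite sum -addnA (leq_trans _ (leq_addr _ _)) // storage_le //.
  by split=> //; left.
have [snd qd] := run_sound dim_graded rn.
have [_ qd'] := step_sound st snd qd.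
rewrite geq_max le_m sum; apply: leq_add (step_space st).
by apply: leq_add; exact: storage_le.
Qed.

End Space.

(** * Correctness and both complexity bounds, assembled *)

Theorem theorem4p1 (R : pzRingType) (T : matrix_routines R)
    (K : realType) (omega : K)
    (time_T : multiplication_exponent T omega) (space_T : quadratic_space T) :
  exists C : K,
    forall (disp : Order.disp_t) (X : finPOrderType disp) (dim : X -> nat)
      (F : parametrization R dim),
    graded dim ->
    terminates T F /\
    forall (time space : nat) (s : state F),
      run T time space s -> final s ->
      let n := #|X| in
      let p := max_upper_covers X in
      let d := max_rank F in
      let m2 := sum_sqr_critical (dim := dim) (matching s) in
      computes_morse s /\
      ((0 < p)%N -> (0 < d)%N ->
         time%:R <= C * (n * p * m2)%:R * d%:R `^ omega /\
         space%:R <= C * (n ^ 2 * p * d ^ 2)%:R).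
Proof.
have [kt kt_bound] := time_T; have [ks ks_bound] := space_T.
(* As a product of d x d matrices has d ^ 2 entries to be written, single operations
   are absorbed by kt * d ^ omega, even though omega is arbitrary. *)
have d2_le (d : nat) : (0 < d)%N -> (d ^ 2)%:R <= kt * d%:R `^ omega.
  move=> d_gt0; have [mul_le _] := kt_bound d d d d d_gt0 (leqnn d) (leqnn d) (leqnn d).
  apply: le_trans (mul_le 0 0); rewrite ler_nat -mulnn.
  exact: mul_time_output.
have kt_ge0 : 0 <= kt.
  have := d2_le 1%N isT; rewrite powR1 mulr1; apply: le_trans; exact: ler0n.
(* The constants for time and for space are both nonnegative, so their sum dominates each. *)
exists (48 * kt + (19 + 4 * ks)%:R) => disp X dim F dim_graded.
split; first exact: scythe_terminates.
move=> time space s rn fin; split.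
  by have [snd _] := run_sound dim_graded rn; exact: sound_computes_morse.
move=> p_gt0 d_gt0; split; last first.
  (* As [p >= 1], a bound by a multiple of [n ^ 2 * d ^ 2] suffices. *)
  apply: (@le_trans _ _ ((19 + 4 * ks) * (#|X| ^ 2 * max_rank F ^ 2))%:R).
    rewrite ler_nat; apply: run_space rn => // [a b c A1 A2|a b A] lea leb.
      by move=> lec; have [-> _] := ks_bound _ a b c d_gt0 lea leb lec.
    by have [_ ->] := ks_bound _ a b a d_gt0 lea leb lea.
  rewrite natrM ler_pM ?ler0n // ?lerDr ?mulr_ge0 //.
  by rewrite ler_nat leq_mul // leq_pmulr.
(* Running times are natural numbers, so a bound by the real [W] is one by its truncation, which
   takes the role of [B]. *)
set W : K := kt * (max_rank F)%:R `^ omega.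
have W_ge0 : 0 <= W by rewrite mulr_ge0 ?powR_ge0.
have truncW k : k%:R <= W -> (k <= Num.truncn W)%N by rewrite truncn_ge_nat.
have W_gt0 : (0 < Num.truncn W)%N.
  apply: truncW; apply: le_trans (d2_le _ d_gt0).
  by rewrite ler_nat expn_gt0 d_gt0.
have : (time <= 48 * (#|X| * max_upper_covers X *
    sum_sqr_critical (dim := dim) (matching s) * Num.truncn W))%N.
  apply: final_time rn fin => // [a b c A1 A2|a b A] lea leb.
    by move=> lec; apply: truncW; have [-> _] := kt_bound _ a b c d_gt0 lea leb lec.
  by apply: truncW; have [_ ->] := kt_bound _ a b a d_gt0 lea leb lea.
rewrite -(ler_nat K) => /le_trans; apply.
set Q := (_ * _ * sum_sqr_critical _)%N.
apply: (@le_trans _ _ (48 * (Q%:R * W))).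
  by rewrite natrM ler_wpM2l ?ler0n // natrM ler_wpM2l ?ler0n // truncn_le.
rewrite [Q%:R * W]mulrC /W -!mulrA [_ `^ _ * Q%:R]mulrC [X in X <= _]mulrA.
by rewrite ler_wpM2r ?mulr_ge0 ?ler0n ?powR_ge0 // lerDl ler0n.
Qed.
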